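(* Let $R$ be a commutative ring with identity. Then the following statements are equivalent. (1) $R$ is a von Neumann regular ring. (2) Every $R$-module has an almost projective envelope which is an epimorphism.
   Context: All rings are commutative with identity and all modules are unitary. An $R$-module $M$ is almost projective if $\mathrm{Ext}^1_R(M,N)=0$ for every maximal ideal $\mathfrak{m}$ of $R$ and every $R_{\mathfrak{m}}$-module $N$ (viewed as an $R$-module). For a class $\mathscr{P}$ of $R$-modules and an $R$-module $M$, an $R$-homomorphism $f:M\to P$ with $P\in\mathscr{P}$ is a $\mathscr{P}$-preenvelope if for every $P'\in\mathscr{P}$ the natural map $\mathrm{Hom}_R(P,P')\to\mathrm{Hom}_R(M,P')$, $g\mapsto gf$, is surjective. It is a $\mathscr{P}$-envelope if moreover every endomorphism $h$ of $P$ with $f=hf$ is an automorphism. An almost projective envelope is a $\mathscr{P}$-envelope for $\mathscr{P}$ the class of almost projective $R$-modules. *)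

(* Defs.v *)
From HB Require Import structures.
From mathcomp Require Import all_boot all_algebra.
From mathcomp Require Import finmap boolp.
From mathcomp Require Import monalg.
From mathcomp Require Import ring.

Set Implicit Arguments.
Unset Strict Implicit.
Unset Printing Implicit Defensive.

Import GRing.Theory.
Local Open Scope ring_scope.
Local Open Scope quotient_scope.

(* Rings are of type [comPzRingType], so that the zero ring is allowed.       *)

Definition von_neumann_regular (R : comPzRingType) : Prop :=
  forall a : R, exists x : R, a = a * x * a.

Section MaximalIdeals.
Variable R : comPzRingType.
Implicit Types I J : {pred R}.

(* Same clauses as [idealr_closed], which is only available for nontrivial    *)
(* rings.                                                                     *)
Definition proper_ideal_closed I : Prop :=
  [/\ 0 \in I, 1 \notin I & forall a : R, {in I &, forall u v, a * u + v \in I}].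

Definition maximal_ideal I : Prop :=
  proper_ideal_closed I /\
  forall J, proper_ideal_closed J -> {subset I <= J} -> {subset J <= I}.

Record maxIdeal := MaxIdeal {
  max_ideal :> {pred R};
  max_idealP : maximal_ideal max_ideal
}.

Fact maxideal_compl_mulr_closed (m : maxIdeal) : mulr_closed [predC m].
Proof.
case: m => m [] [m0 m1 mD] mmax; split=> [|x y]; first by rewrite inE.
rewrite !inE /= => xNm yNm; apply/negP => xym.
have mM a u : u \in m -> a * u \in m by move=> um; rewrite -[a * u]addr0 mD.
pose J : {pred R} := [pred z : R | `[< exists a, z - a * x \in m >]].
have mJ : {subset m <= J}.
  by move=> z zm; apply/asboolP; exists 0; rewrite mul0r subr0.
have xJ : x \in J by apply/asboolP; exists 1; rewrite mul1r subrr.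
case: (boolP (1 \in J)) => [/asboolP[a axm]|J1]; last first.
  case/negP: xNm; apply: (mmax J) => //; split=> //; first exact: mJ.
  move=> a u v /asboolP[b ub] /asboolP[c vc]; apply/asboolP.
  exists (a * b + c).
  have -> : a * u + v - (a * b + c) * x = a * (u - b * x) + (v - c * x).
    by ring.
  exact: mD.
case/negP: yNm; have -> : y = y * (1 - a * x) + a * (x * y) by ring.
by apply: mD (mM _ _ xym).
Qed.

End MaximalIdeals.

Definition maxideal_compl (R : comPzRingType) (m : maxIdeal R) : {pred R} :=
  [predC m].

HB.instance Definition _ (R : comPzRingType) (m : maxIdeal R) :=
  GRing.isMulClosed.Build R (maxideal_compl m) (maxideal_compl_mulr_closed m).

Section Localization.
Variables (R : comPzRingType) (S : mulrClosed R).

Local Notation den := {s : R | s \in S}.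
Local Notation pre := (R * den)%type.

Definition loc_den1 : den := Sub 1 (rpred1 S).
Definition loc_denM (s t : den) : den :=
  Sub (sval s * sval t) (rpredM (svalP s) (svalP t)).

(* The pair [(a, s)] stands for the fraction a/s.                             *)
Definition loc_equiv (x y : pre) : bool :=
  `[< exists2 u, u \in S & u * (x.1 * sval y.2) = u * (y.1 * sval x.2) >].

Fact loc_equiv_refl : reflexive loc_equiv.
Proof. by move=> x; apply/asboolP; exists 1; rewrite ?rpred1. Qed.

Fact loc_equiv_sym : symmetric loc_equiv.
Proof.
by move=> x y; apply/asboolP/asboolP => -[u uS xy]; exists u; rewrite ?xy.
Qed.

Fact loc_equiv_trans : transitive loc_equiv.
Proof.
move=> [b [t tS]] [a [s sS]] [c [r rS]] /asboolP[u uS /= xy] /asboolP[v vS /= yz].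
apply/asboolP; exists (u * v * t) => /=; first by rewrite !rpredM.
transitivity (v * r * (u * (a * t))); first by ring.
rewrite xy; transitivity (u * s * (v * (b * r))); first by ring.
by rewrite yz; ring.
Qed.

Canonical loc_equiv_equiv :=
  EquivRel loc_equiv loc_equiv_refl loc_equiv_sym loc_equiv_trans.

Definition localization : Type := {eq_quot loc_equiv}.
HB.instance Definition _ : EqQuotient _ loc_equiv localization :=
  EqQuotient.on localization.
HB.instance Definition _ := Choice.on localization.

Definition loc_frac (a : R) (s : den) : localization := \pi_localization (a, s).

Fact loc_frac_eqP (a b : R) (s t : den) :
  reflect (exists2 u, u \in S & u * (a * sval t) = u * (b * sval s))
          (loc_frac a s == loc_frac b t).
Proof. by rewrite /loc_frac piE; apply: asboolP. Qed.

Fact loc_fracP (x : localization) : {a : R & {s : den | x = loc_frac a s}}.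
Proof.
by exists (repr x).1, (repr x).2; rewrite /loc_frac -surjective_pairing reprK.
Qed.

Definition loc_add (x y : localization) : localization :=
  let: (a, s) := repr x in let: (b, t) := repr y in
  loc_frac (a * sval t + b * sval s) (loc_denM s t).
Definition loc_opp (x : localization) : localization :=
  let: (a, s) := repr x in loc_frac (- a) s.
Definition loc_mul (x y : localization) : localization :=
  let: (a, s) := repr x in let: (b, t) := repr y in
  loc_frac (a * b) (loc_denM s t).

Fact loc_repr_fracP (a : R) (s : den) :
  exists b t, repr (loc_frac a s) = (b, t) /\
    exists2 u, u \in S & u * (b * sval s) = u * (a * sval t).
Proof.
case E: (repr (loc_frac a s)) => [b t]; exists b, t; split=> //.
by apply/loc_frac_eqP; rewrite {1}/loc_frac -E reprK.
Qed.

Fact loc_addE a s b t :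
  loc_add (loc_frac a s) (loc_frac b t) = loc_frac (a * sval t + b * sval s) (loc_denM s t).
Proof.
rewrite /loc_add.
have [a' [s' [-> [u uS au]]]] := loc_repr_fracP a s.
have [b' [t' [-> [v vS bv]]]] := loc_repr_fracP b t.
apply/eqP/loc_frac_eqP; exists (u * v) => /=; first by rewrite rpredM.
transitivity (v * sval t' * sval t * (u * (a' * sval s))
              + u * sval s' * sval s * (v * (b' * sval t))); first by ring.
by rewrite au bv; ring.
Qed.

Fact loc_oppE a s : loc_opp (loc_frac a s) = loc_frac (- a) s.
Proof.
rewrite /loc_opp; have [a' [s' [-> [u uS au]]]] := loc_repr_fracP a s.
by apply/eqP/loc_frac_eqP; exists u => //; rewrite !mulNr !mulrN au.
Qed.

Fact loc_mulE a s b t :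
  loc_mul (loc_frac a s) (loc_frac b t) = loc_frac (a * b) (loc_denM s t).
Proof.
rewrite /loc_mul.
have [a' [s' [-> [u uS au]]]] := loc_repr_fracP a s.
have [b' [t' [-> [v vS bv]]]] := loc_repr_fracP b t.
apply/eqP/loc_frac_eqP; exists (u * v) => /=; first by rewrite rpredM.
transitivity ((u * (a' * sval s)) * (v * (b' * sval t))); first by ring.
by rewrite au bv; ring.
Qed.

Fact loc_frac_eq a s b t : a * sval t = b * sval s -> loc_frac a s = loc_frac b t.
Proof. by move=> e; apply/eqP/loc_frac_eqP; exists 1; rewrite ?rpred1 ?e. Qed.

Fact loc_addA : associative loc_add.
Proof.
move=> x y z; have [a [s ->]] := loc_fracP x; have [b [t ->]] := loc_fracP y.
have [c [r ->]] := loc_fracP z; rewrite !loc_addE; apply: loc_frac_eq => /=; ring.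
Qed.

Fact loc_addC : commutative loc_add.
Proof.
move=> x y; have [a [s ->]] := loc_fracP x; have [b [t ->]] := loc_fracP y.
rewrite !loc_addE; apply: loc_frac_eq => /=; ring.
Qed.

Fact loc_add0 : left_id (loc_frac 0 loc_den1) loc_add.
Proof.
move=> x; have [a [s ->]] := loc_fracP x.
rewrite loc_addE; apply: loc_frac_eq => /=; ring.
Qed.

Fact loc_addN : left_inverse (loc_frac 0 loc_den1) loc_opp loc_add.
Proof.
move=> x; have [a [s ->]] := loc_fracP x.
rewrite loc_oppE loc_addE; apply: loc_frac_eq => /=; ring.
Qed.

Fact loc_mulA : associative loc_mul.
Proof.
move=> x y z; have [a [s ->]] := loc_fracP x; have [b [t ->]] := loc_fracP y.
have [c [r ->]] := loc_fracP z; rewrite !loc_mulE; apply: loc_frac_eq => /=; ring.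
Qed.

Fact loc_mulC : commutative loc_mul.
Proof.
move=> x y; have [a [s ->]] := loc_fracP x; have [b [t ->]] := loc_fracP y.
rewrite !loc_mulE; apply: loc_frac_eq => /=; ring.
Qed.

Fact loc_mul1 : left_id (loc_frac 1 loc_den1) loc_mul.
Proof.
move=> x; have [a [s ->]] := loc_fracP x.
rewrite loc_mulE; apply: loc_frac_eq => /=; ring.
Qed.

Fact loc_mulD : left_distributive loc_mul loc_add.
Proof.
move=> x y z; have [a [s ->]] := loc_fracP x; have [b [t ->]] := loc_fracP y.
have [c [r ->]] := loc_fracP z.
rewrite !(loc_addE, loc_mulE); apply: loc_frac_eq => /=; ring.
Qed.

HB.instance Definition _ :=
  GRing.isZmodule.Build localization loc_addA loc_addC loc_add0 loc_addN.
HB.instance Definition _ :=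
  GRing.Zmodule_isComPzRing.Build localization loc_mulA loc_mulC loc_mul1 loc_mulD.

Definition loc_map (a : R) : localization := loc_frac a loc_den1.

Fact loc_map_is_zmod_morphism : zmod_morphism loc_map.
Proof.
move=> a b; transitivity (loc_add (loc_map a) (loc_opp (loc_map b))) => //.
rewrite loc_oppE loc_addE; apply: loc_frac_eq => /=; ring.
Qed.

Fact loc_map_is_monoid_morphism : monoid_morphism loc_map.
Proof.
split=> // a b; transitivity (loc_mul (loc_map a) (loc_map b)) => //.
rewrite loc_mulE; apply: loc_frac_eq => /=; ring.
Qed.

HB.instance Definition _ :=
  GRing.isZmodMorphism.Build R localization loc_map loc_map_is_zmod_morphism.
HB.instance Definition _ :=
  GRing.isMonoidMorphism.Build R localization loc_map loc_map_is_monoid_morphism.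

End Localization.

Section RestrictionOfScalars.
Variables (R S : pzRingType) (phi : {rmorphism R -> S}) (N : lmodType S).

(* The vacuous abstraction records phi in the type, where it selects the      *)
(* R-module structure.                                                        *)
Definition restrict_scalars : Type := (fun=> N) phi.
HB.instance Definition _ := GRing.Zmodule.on restrict_scalars.

Definition restrict_scale (a : R) (x : restrict_scalars) : restrict_scalars :=
  phi a *: (x : N).

Fact restrict_scaleA a b x :
  restrict_scale a (restrict_scale b x) = restrict_scale (a * b) x.
Proof. by rewrite /restrict_scale scalerA rmorphM. Qed.

Fact restrict_scale1 : left_id 1 restrict_scale.
Proof. by move=> x; rewrite /restrict_scale rmorph1 scale1r. Qed.

Fact restrict_scaleDr : right_distributive restrict_scale +%R.
Proof. by move=> a x y; rewrite /restrict_scale scalerDr. Qed.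

Fact restrict_scaleDl x : {morph restrict_scale^~ x : a b / a + b}.
Proof. by move=> a b; rewrite /restrict_scale rmorphD scalerDl. Qed.

HB.instance Definition _ := GRing.Zmodule_isLmodule.Build R restrict_scalars
  restrict_scaleA restrict_scale1 restrict_scaleDr restrict_scaleDl.

End RestrictionOfScalars.

Section FreeModule.
Variables (R : pzRingType) (X : choiceType).

(* The finitely supported functions X -> R. The module structure of           *)
(* [{malg R[X]}] itself is only declared for nontrivial rings.                *)
Definition free_module : Type := {malg R[X]}.
HB.instance Definition _ := GRing.Zmodule.on free_module.

Definition free_scale (c : R) (f : free_module) : free_module :=
  [malg x in msupp f => c * f@_x].

Fact free_scaleE c f x : (free_scale c f)@_x = c * f@_x.
Proof. by rewrite mcoeffE; case: msuppP; rewrite ?mulr0. Qed.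

Fact free_scaleA a b f : free_scale a (free_scale b f) = free_scale (a * b) f.
Proof. by apply/malgP => x; rewrite !free_scaleE mulrA. Qed.

Fact free_scale1 : left_id 1 free_scale.
Proof. by move=> f; apply/malgP => x; rewrite free_scaleE mul1r. Qed.

Fact free_scaleDr : right_distributive free_scale +%R.
Proof.
move=> a f g; apply/malgP => x.
by rewrite !(free_scaleE, mcoeffD) mulrDr.
Qed.

Fact free_scaleDl f : {morph free_scale^~ f : a b / a + b}.
Proof.
move=> a b; apply/malgP => x.
by rewrite !(free_scaleE, mcoeffD) mulrDl.
Qed.

HB.instance Definition _ := GRing.Zmodule_isLmodule.Build R free_module
  free_scaleA free_scale1 free_scaleDr free_scaleDl.

Variables (V : lmodType R) (g : X -> V).

(* The linear extension of g to the free module on X.                         *)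
Definition free_lift (f : free_module) : V :=
  \sum_(x <- msupp f) f@_x *: g x.

Fact free_liftEw (f : free_module) (D : {fset X}) : (msupp f `<=` D)%fset ->
  free_lift f = \sum_(x <- D) f@_x *: g x.
Proof.
move=> fD; apply: big_fset_incl => // x _ xf.
by rewrite mcoeff_outdom // scale0r.
Qed.

Fact free_lift_is_linear : linear free_lift.
Proof.
move=> a f h; pose D := (msupp f `|` msupp h `|` msupp (a *: f + h))%fset.
have fD : (msupp f `<=` D)%fset by rewrite /D -fsetUA fsubsetUl.
have hD : (msupp h `<=` D)%fset by rewrite /D fsetUAC fsubsetUr.
have fhD : (msupp (a *: f + h) `<=` D)%fset by rewrite /D fsubsetUr.
rewrite (free_liftEw fD) (free_liftEw hD) (free_liftEw fhD).
rewrite scaler_sumr -big_split; apply: eq_bigr => x _ /=.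
by rewrite mcoeffD free_scaleE scalerDl scalerA.
Qed.

HB.instance Definition _ :=
  GRing.isLinear.Build R free_module V _ free_lift free_lift_is_linear.

End FreeModule.

Section Ext1.
Variables (R : pzRingType) (M : lmodType R).

Definition ker_type (V W : lmodType R) (f : {linear V -> W}) : choiceType :=
  {x : V | f x == 0}.

(* The first terms F2 -> F1 -> F0 -> M of the standard free resolution of M:  *)
(* F0 is free on the elements of M and, at each later stage, the next module  *)
(* is free on the elements of the kernel of the last map.                     *)
Definition res_F0 : lmodType R := free_module R M.
Definition res_aug : {linear res_F0 -> M} := free_lift (@id M).

Definition res_F1 : lmodType R := free_module R (ker_type res_aug).
Definition res_d1 : {linear res_F1 -> res_F0} :=
  free_lift (val : ker_type res_aug -> res_F0).

Definition res_F2 : lmodType R := free_module R (ker_type res_d1).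
Definition res_d2 : {linear res_F2 -> res_F1} :=
  free_lift (val : ker_type res_d1 -> res_F1).

(* Ext^1_R(M, N) is the cohomology at Hom_R(F1, N) of                         *)
(*   Hom_R(F0, N) -> Hom_R(F1, N) -> Hom_R(F2, N).                            *)
Definition Ext1_cocycle (N : lmodType R) (c : {linear res_F1 -> N}) : Prop :=
  forall x, c (res_d2 x) = 0.

Definition Ext1_coboundary (N : lmodType R) (c : {linear res_F1 -> N}) : Prop :=
  exists b : {linear res_F0 -> N}, forall x, c x = b (res_d1 x).

Definition Ext1_eq0 (N : lmodType R) : Prop :=
  forall c : {linear res_F1 -> N}, Ext1_cocycle c -> Ext1_coboundary c.

End Ext1.

Definition almost_projective (R : comPzRingType) (M : lmodType R) : Prop :=
  forall (m : maxIdeal R) (N : lmodType (localization (maxideal_compl m))),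
    Ext1_eq0 M (restrict_scalars (loc_map (maxideal_compl m)) N).

Section Envelopes.
Variables (R : pzRingType) (C : lmodType R -> Prop).

Definition preenvelope (M P : lmodType R) (f : {linear M -> P}) : Prop :=
  C P /\
  forall P' : lmodType R, C P' ->
    forall k : {linear M -> P'}, exists g : {linear P -> P'}, g \o f =1 k.

Definition envelope (M P : lmodType R) (f : {linear M -> P}) : Prop :=
  preenvelope f /\
  forall h : {linear P -> P}, h \o f =1 f -> bijective h.

End Envelopes.

Definition surjective (A B : Type) (f : A -> B) : Prop :=
  forall y, exists x, f x = y.

(* Main.v *)
Require Import Defs.
From mathcomp Require Import all_boot all_algebra.
From HB Require Import structures.
From mathcomp Require Import finmap boolp classical_sets functions.
From mathcomp Require Import monalg.
From mathcomp Require Import ring.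

Set Implicit Arguments.
Unset Strict Implicit.
Unset Printing Implicit Defensive.

(** Over a von Neumann regular ring each local ring R_m kills the elements of m
    and inverts the others, so an R_m-module N satisfies, for every a in R,
    one of two alternatives: a is invertible on N, or a is annihilated by some e
    that is injective on N. This makes N injective over R by the usual
    one-element extension argument ([Ext1_eq0_dichotomy]), every module is
    almost projective, and the identity map is an envelope.

    Conversely, suppose that envelopes exist and are onto. If the linear forms
    of L separate its points, then its envelope L -> P is injective, because R
    itself is almost projective, hence bijective, and L inherits from P the
    lifting property of almost projective modules ([lifts_locally_separated]).
    All ideals of R and the module of sequences R^nat are of this kind. Lifting
    a map h : L -> Y into an R_m-module Y through the free R_m-module on L gives
    a dual basis h l = sum_x (coord x l) h x in which, for each l, almost all
    coordinates vanish ([local_dual_basis]). Put V = R_m and let a be in m with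
    a <> 0 in V.
    - The dual basis of the ideal a R shows that a is regular in V
      ([loc_regular]).
    - The dual basis of the ideal of the elements divisible by all powers of a
      shows that V is a-adically separated ([loc_separated]).
    - In R^nat, with unit vectors e_i, choose exponents K(i) growing so fast
      that coord x e_i, when nonzero, is not divisible by a^(K(i+1) - K(i)).
      If coord x vanishes at d = (a^K(i))_i, then it vanishes at every e_i. So
      only the finitely many coordinates in the support of d matter on the e_i,
      and the infinite identity matrix factors through a finite free module.
    The last point is absurd, so every element of m vanishes in R_m
    ([maxideal_locally_zero]). Then for each a the ideal of the r such that
    r a lies in a R a, which contains a, is in no maximal ideal: it contains 1,
    and R is von Neumann regular. *)

Import GRing.Theory.
Local Open Scope classical_set_scope.
Local Open Scope ring_scope.

(** * Zorn's lemma and maximal ideals *)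

Lemma Zorn_above T (P : set (set T)) (A0 : set T) : P A0 ->
  (forall F : set (set T), F `<=` P -> F !=set0 -> total_on F subset ->
    P (\bigcup_(A in F) A)%classic) ->
  exists A, [/\ P A, A0 `<=` A & forall B, P B -> A `<=` B -> B `<=` A]%classic.
Proof.
move=> PA0 Pchain.
have [F FP Ftot|A [PA Amax]] := @Zorn_bigcup T (fun A => P (A0 `|` A)%classic).
  have [->|/set0P[A1 FA1]] := eqVneq F set0; first by rewrite bigcup_set0 setU0.
  have -> : (A0 `|` \bigcup_(A in F) A =
      \bigcup_(B in [set (A0 `|` A) | A in F]) B)%classic.
    apply/seteqP; split=> [x [A0x|[A FA Ax]]|x [_ [A FA <-] [A0x|Ax]]].
    - by exists (A0 `|` A1)%classic; [exists A1 | left].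
    - by exists (A0 `|` A)%classic; [exists A | right].
    - by left.
    - by right; exists A.
  apply: Pchain; first by move=> _ [A FA <-]; exact: FP.
    by exists (A0 `|` A1)%classic, A1.
  move=> _ _ [A FA <-] [B FB <-].
  by case: (Ftot _ _ FA FB) => AB; [left|right]; apply: setUS.
exists (A0 `|` A)%classic; split=> [||B PB AB x Bx]; [by []|exact: subsetUl|].
apply: contrapT => nABx; apply: (Amax B); last first.
  by rewrite (_ : _ `|` _ = B)%classic //; apply/setUidPr => y yA; apply: AB; left.
split=> [y yA|BA]; first by apply: AB; right.
by apply: nABx; right; exact: BA.
Qed.

Lemma total_on_common T (F : set (set T)) x y : total_on F subset ->
  (\bigcup_(A in F) A)%classic x -> (\bigcup_(A in F) A)%classic y ->
  exists2 A, F A & A x /\ A y.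
Proof.
move=> Ftot [A FA Ax] [B FB By].
by case: (Ftot _ _ FA FB) => AB; [exists B|exists A]; rewrite //; split=> //;
  exact: AB.
Qed.

Lemma maximal_ideal_above (R : comPzRingType) (I : {pred R}) :
  proper_ideal_closed I -> exists m : maxIdeal R, {subset I <= m}.
Proof.
move=> I_ideal.
pose P (A : set R) := proper_ideal_closed (mem A).
have [||A [PA IA Amax]] := @Zorn_above R P [set x | x \in I].
- case: I_ideal => I0 I1 ID; split; rewrite ?inE //=.
    by apply/negP; rewrite inE; apply/negP.
  by move=> a u v; rewrite !inE /= => uI vI; exact: ID.
- move=> F FP [A0 FA0] Ftot; split.
  + rewrite inE; exists A0 => //.
    by have [A00 _ _] := FP _ FA0; rewrite inE in A00.
  + apply/negP; rewrite inE => -[A FA A1].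
    by have [_ /negP nA1 _] := FP _ FA; apply: nA1; rewrite inE.
  + move=> a u v; rewrite !inE => Fu Fv.
    have [C FC [Cu Cv]] := total_on_common Ftot Fu Fv.
    exists C => //; have [_ _ /(_ a u v)] := FP _ FC.
    by rewrite !inE; exact.
have maxA : maximal_ideal (mem A).
  split=> // J J_ideal AJ x xJ.
  rewrite inE; apply: (Amax [set x | x \in J]%classic) => //.
    case: J_ideal => J0 J1 JD; split; rewrite ?inE //=.
      by apply/negP; rewrite inE; apply/negP.
    by move=> a u v; rewrite !inE /= => uI vI; exact: JD.
  by move=> y Ay /=; apply: AJ; rewrite inE.
by exists (MaxIdeal maxA) => x xI; rewrite inE; exact: IA.
Qed.

(** * The standard free resolution *)

Lemma linear_map_of (R : pzRingType) (V W : lmodType R) (f : V -> W) :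
  linear f -> exists g : {linear V -> W}, g =1 f.
Proof.
move=> f_lin; pose fL := GRing.isLinear.Build R V W _ f f_lin.
by exists (HB.pack f fL : {linear V -> W}).
Qed.

Section FreeModuleTheory.
Variables (R : pzRingType) (X : choiceType).

Definition free_unit (x : X) : free_module R X := mkmalgU x 1.

Lemma free_lift_unit (V : lmodType R) (g : X -> V) x :
  free_lift g (free_unit x) = g x.
Proof.
rewrite (@free_liftEw _ _ _ g _ [fset x]%fset) ?msuppU_le //.
by rewrite big_seq_fset1 mcoeffUU scale1r.
Qed.

Lemma linear_free_lift (V W : lmodType R) (g : X -> V) (f : {linear V -> W}) u :
  f (free_lift g u) = free_lift (f \o g) u.
Proof.
by rewrite linear_sum; apply: eq_bigr => x _; rewrite linearZ.
Qed.

End FreeModuleTheory.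

Section FreeKernel.
Variables (R : pzRingType) (V W : lmodType R) (f : {linear V -> W}).

Lemma free_ker_lift0 u : f (free_lift (val : ker_type f -> V) u) = 0.
Proof.
rewrite linear_free_lift /free_lift big1 // => x _ /=.
by rewrite (eqP (valP x)) scaler0.
Qed.

Lemma free_ker_lift_onto v : f v = 0 ->
  exists u, free_lift (val : ker_type f -> V) u = v.
Proof.
by move=> /eqP fv0; exists (free_unit R (Sub v fv0)); rewrite free_lift_unit SubK.
Qed.

End FreeKernel.

Lemma res_aug_unit (R : pzRingType) (L : lmodType R) (l : L) :
  res_aug L (free_unit R l) = l.
Proof. exact: free_lift_unit. Qed.

(** F1 -> F0 -> L -> 0 is exact, so L is the cokernel of F1 -> F0. *)
Lemma res_descend (R : pzRingType) (L W : lmodType R)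
    (d : {linear res_F0 L -> W}) :
  (forall y, d (res_d1 L y) = 0) ->
  exists phi : {linear L -> W}, forall u, phi (res_aug L u) = d u.
Proof.
move=> d0; pose phi l := d (free_unit R l).
have phi_aug u : phi (res_aug L u) = d u.
  apply/eqP; rewrite eq_sym -subr_eq0 -linearB.
  have [|y <-] := @free_ker_lift_onto _ _ _ (res_aug L)
    (u - free_unit R (res_aug L u)); last exact/eqP/d0.
  by rewrite linearB /= res_aug_unit subrr.
have [|psi psiE] := linear_map_of (f := phi).
  move=> a l l'.
  transitivity (phi (res_aug L (a *: free_unit R l + free_unit R l'))).
    by rewrite linearP !res_aug_unit.
  by rewrite phi_aug linearP.
by exists psi => u; rewrite psiE.
Qed.

(** The second step of the resolution is exact, so a cocycle is the same thing as
    a linear map on the image of F1 -> F0, and Ext^1 can be studied without F2. *)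
Lemma cocycle_ker (R : pzRingType) (M N : lmodType R)
    (c : {linear res_F1 M -> N}) :
  Ext1_cocycle c -> forall y, res_d1 M y = 0 -> c y = 0.
Proof. by move=> c0 y /free_ker_lift_onto[z <-]; exact: c0. Qed.

(** * Extending partial linear maps; vanishing of Ext^1 *)

(** Partial linear maps from F to N are represented by their graphs: inclusion
    of graphs is the extension order, and unions of chains are again graphs. *)
Section LinearRelation.
Variables (R : comPzRingType) (F N : lmodType R).

Definition linear_relation (G : set (F * N)) : Prop :=
  forall (a : R) p q, G p -> G q -> G (a *: p + q).

Definition single_valued (G : set (F * N)) : Prop :=
  forall y, G (0, y) -> y = 0.

Lemma linear_relation_graph G : linear_relation G -> single_valued G ->
  (forall u, exists y, G (u, y)) ->
  exists b : {linear F -> N}, forall u y, G (u, y) -> b u = y.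
Proof.
move=> Glin Gsv Gtot; have [b Gb] := choice Gtot.
have bE u y : G (u, y) -> b u = y.
  move=> Guy; apply/esym/eqP; rewrite -subr_eq0; apply/eqP/Gsv.
  have := Glin (-1) _ _ (Gb u) Guy.
  by rewrite scaleN1r addrC; congr (G (_, _)); rewrite /= ?subrr.
have b_lin : linear b.
  by move=> a u v; apply: bE; exact: (Glin a _ _ (Gb u) (Gb v)).
pose bL := GRing.isLinear.Build R F N _ b b_lin.
pose B : {linear F -> N} := HB.pack b bL.
by exists B.
Qed.

(** Over a von Neumann regular ring, the R_m-modules satisfy this dichotomy; it
    is what makes the one-step extension of a partial linear map possible. *)
Hypothesis N_dichotomy : forall a : R,
  (exists b : R, forall y : N, b *: (a *: y) = y) \/
  (exists2 e : R, e * a = 0 & forall y : N, e *: y = 0 -> y = 0).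

Lemma linear_relation_total (G0 : set (F * N)) :
  linear_relation G0 -> single_valued G0 -> G0 (0, 0) ->
  exists G, [/\ linear_relation G, single_valued G,
    (G0 `<=` G)%classic & forall u, exists y, G (u, y)].
Proof.
move=> G0lin G0sv G00.
pose P (G : set (F * N)) := linear_relation G /\ single_valued G.
have [||G [[Glin Gsv] G0G Gmax]] := @Zorn_above _ P G0.
- by [].
- move=> A AP [A0 AA0] Atot; split.
    move=> a p q Ap Aq; have [E EA [Ep Eq]] := total_on_common Atot Ap Aq.
    by exists E => //; case: (AP _ EA) => Elin _; exact: Elin.
  by move=> y [C CA Cy]; case: (AP _ CA) => _; exact.
exists G; split=> // u0.
have GZ a p : G p -> G (a *: p).
  by move=> Gp; rewrite -[a *: p]addr0; apply: Glin => //; exact: G0G.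
have GN u y v z : G (u, y) -> G (v, z) -> G (u - v, y - z).
  move=> Gu Gv; have := Glin (-1) _ _ Gv Gu.
  by rewrite scaleN1r addrC.
(* The value y0 to be given to u0 is forced as soon as some multiple r u0 with r
   invertible on N is in the domain. Otherwise every multiple of u0 in the domain
   has value 0, as e kills it for an e that is injective on N. *)
have [y0 y0P] : exists y0, forall r y, G (r *: u0, y) -> y = r *: y0.
  have [[r [y [[s sK] Gry]]]|nunit] := pselect (exists (r : R) y,
      (exists s : R, forall z : N, s *: (r *: z) = z) /\ G (r *: u0, y)).
    exists (s *: y) => r' y' Gry'.
    have rs0 : r *: y' - r' *: y = 0.
      apply: Gsv; have := GN _ _ _ _ (GZ r _ Gry') (GZ r' _ Gry).
      by rewrite !scalerA mulrC subrr.
    move/eqP: rs0; rewrite subr_eq0 => /eqP rs.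
    by rewrite -[LHS]sK rs !scalerA mulrC.
  exists 0 => r y Gry; rewrite scaler0.
  have [runit|[e er0 e_inj]] := N_dichotomy r.
    by case: nunit; exists r, y.
  apply: e_inj; apply: Gsv; have := GZ e _ Gry.
  rewrite (_ : e *: _ = (0, e *: y)) //.
  by congr (_, _); rewrite scalerA er0 scale0r.
pose G1 : set (F * N) :=
  [set p | exists r, G (p.1 + r *: u0, p.2 + r *: y0)]%classic.
have PG1 : P G1.
  split.
    move=> a p q [r Gr] [s Gs]; exists (a * r + s).
    have := Glin a _ _ Gr Gs; congr (G (_, _));
      by rewrite /= scalerDr scalerDl scalerA addrACA.
  move=> y [r] /=; rewrite add0r => /y0P ry.
  by apply: (addIr (r *: y0)); rewrite add0r.
have GG1 : (G `<=` G1)%classic.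
  by move=> -[u y] Gu; exists 0; rewrite !scale0r !addr0.
exists y0; apply: (Gmax G1) => //; exists (-1) => /=.
by rewrite !scaleN1r !subrr; exact: G0G.
Qed.

End LinearRelation.

(** A cocycle c defines a partial linear map F0 -> N with domain the image of F1;
    a total extension of it is a cochain with coboundary c. *)
Lemma Ext1_eq0_dichotomy (R : comPzRingType) (M N : lmodType R) :
  (forall a : R,
    (exists b : R, forall y : N, b *: (a *: y) = y) \/
    (exists2 e : R, e * a = 0 & forall y : N, e *: y = 0 -> y = 0)) ->
  Ext1_eq0 M N.
Proof.
move=> N_dich c c0.
pose G0 : set (res_F0 M * N) := [set p | exists x, p = (res_d1 M x, c x)]%classic.
have [|||G [Glin Gsv G0G Gtot]] := linear_relation_total N_dich (G0 := G0).
- by move=> a _ _ [x ->] [y ->]; exists (a *: x + y); rewrite !linearP.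
- by move=> y [x [/esym /(cocycle_ker c0) -> ->]].
- by exists 0; rewrite !linear0.
have [b bE] := linear_relation_graph Glin Gsv Gtot.
by exists b => x; apply/esym/bE/G0G; exists x.
Qed.

(** * Localization at a maximal ideal *)

Definition maxloc (R : comPzRingType) (m : maxIdeal R) : comPzRingType :=
  localization (maxideal_compl m).

Definition to_maxloc (R : comPzRingType) (m : maxIdeal R) :
  {rmorphism R -> maxloc m} := loc_map (maxideal_compl m).

Section LocalRing.
Variables (R : comPzRingType) (m : maxIdeal R).
Local Notation V := (maxloc m).
Local Notation iota := (to_maxloc m).

Lemma maxideal_lin a u v : u \in m -> v \in m -> a * u + v \in m.
Proof. by case: m => I [[_ _ ID] _] /= uI vI; exact: ID. Qed.

Lemma maxideal0 : 0 \in m. Proof. by case: m => I [[]]. Qed.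

Lemma maxideal1 : 1 \notin m. Proof. by case: m => I [[]]. Qed.

Lemma maxidealM a u : u \in m -> a * u \in m.
Proof. by move=> um; rewrite -[_ * _]addr0 maxideal_lin ?maxideal0. Qed.

Lemma loc_map_inv s : s \notin m -> exists w : V, w * iota s = 1.
Proof.
move=> sm; exists (loc_frac 1 (Sub s sm : {s | s \in maxideal_compl m})).
change (loc_mul (loc_frac 1 (Sub s sm : {s | s \in maxideal_compl m}))
  (iota s) = loc_frac 1 (loc_den1 _)).
by rewrite loc_mulE; apply: loc_frac_eq => /=; ring.
Qed.

Lemma loc_map_cancel s (v : V) : s \notin m -> iota s * v = 0 -> v = 0.
Proof.
move=> /loc_map_inv[w ws1] sv0.
by rewrite -[v]mul1r -ws1 -mulrA sv0 mulr0.
Qed.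

Lemma loc_map_num (v : V) : exists b s, s \notin m /\ iota s * v = iota b.
Proof.
have [b [[s sS] ->]] := loc_fracP v; exists b, s; split; first by [].
change (loc_mul (iota s) (loc_frac b (exist _ s sS)) = iota b).
by rewrite loc_mulE; apply: loc_frac_eq => /=; ring.
Qed.

Lemma loc_map_eq a b : iota a = iota b -> exists2 s, s \notin m & s * a = s * b.
Proof.
move=> /eqP/loc_frac_eqP[s sS /=]; rewrite !mulr1 => sab.
by exists s.
Qed.

Lemma loc_map_eq0 a : iota a = 0 -> exists2 s, s \notin m & s * a = 0.
Proof.
by rewrite -(rmorph0 iota) => /loc_map_eq[s sm]; rewrite mulr0; exists s.
Qed.

Lemma loc1_neq0 : (1 : V) != 0.
Proof.
apply/negP => /eqP; rewrite -(rmorph1 iota) => /loc_map_eq0[s sm].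
by rewrite mulr1 => s0; rewrite s0 maxideal0 in sm.
Qed.

(** If v = b/s, then 1 - a v = (s - a b)/s is a unit, for s - a b is not in m. *)
Lemma loc_nakayama a (v r : V) : a \in m -> r = iota a * v * r -> r = 0.
Proof.
move=> am rE; have [b [s [sm svb]]] := loc_map_num v.
apply: (@loc_map_cancel (s - a * b)).
  apply/negP => sabm; case/negP: sm.
  have -> : s = b * a + (s - a * b) by ring.
  exact: maxideal_lin.
rewrite rmorphB rmorphM -svb.
transitivity (iota s * (r - iota a * v * r)); first by ring.
by rewrite -rE subrr mulr0.
Qed.

End LocalRing.

Lemma vnr_almost_projective (R : comPzRingType) (M : lmodType R) :
  von_neumann_regular R -> almost_projective M.
Proof.
move=> vnr m N; apply: Ext1_eq0_dichotomy => a.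
have iota_inj s (sm : s \notin m) (y : N) :
  to_maxloc m s *: y = 0 -> y = 0.
  have [w ws1] := loc_map_inv sm.
  by move=> sy0; rewrite -[y]scale1r -ws1 -scalerA sy0 scaler0.
have [am|am] := boolP (a \in m).
  right; have [x axa] := vnr a; exists (1 - x * a).
    by rewrite mulrBl mul1r -mulrA -[X in X - _]mul1r {1}axa; ring.
  apply: iota_inj; apply/negP => /(maxideal_lin 1 (maxidealM x am)).
  by rewrite mul1r addrC subrK (negPf (maxideal1 m)).
left; have [x axa] := vnr a; exists x => y.
apply/eqP; rewrite -subr_eq0; apply/eqP; apply: (iota_inj _ am).
change (a *: (x *: (a *: y) - y) = 0).
by rewrite scalerBr !scalerA mulrA -axa subrr.
Qed.

(** * The lifting property *)

Section Submodule.
Variables (R : pzRingType) (V : lmodType R) (S : submodClosed V).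

Definition submodule : Type := {x : V | x \in S}.

HB.instance Definition _ := SubChoice.on submodule.
HB.instance Definition _ := [SubChoice_isSubLmodule of submodule by <:].

End Submodule.

Section Kernel.
Variables (R : pzRingType) (V W : lmodType R) (f : {linear V -> W}).

Definition kernel : {pred V} := [pred x | f x == 0].

Fact kernel_submod_closed : submod_closed kernel.
Proof.
split=> [|a x y]; rewrite !inE ?linear0 // => /eqP x0 /eqP y0.
by rewrite linearP x0 y0 scaler0 addr0.
Qed.

HB.instance Definition _ :=
  GRing.isSubmodClosed.Build R V kernel kernel_submod_closed.

End Kernel.

Definition lifts_locally (R : comPzRingType) (L : lmodType R) : Prop :=
  forall (m : maxIdeal R) (X Y : lmodType (maxloc m)) (rho : {linear X -> Y})
    (h : {linear L -> restrict_scalars (to_maxloc m) Y}),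
  (forall l, exists x, rho x = h l) ->
  exists phi : {linear L -> restrict_scalars (to_maxloc m) X},
    forall l, rho (phi l) = h l.

(** The obstruction to lifting h lies in Ext^1 with values in the kernel of rho,
    which is an R_m-module: lift h on the free module F0, restrict to F1, and
    correct by a cochain. *)
Lemma almost_projective_lifts (R : comPzRingType) (L : lmodType R) :
  almost_projective L -> lifts_locally L.
Proof.
move=> apL m X Y rho h /choice[g gP].
pose res := restrict_scalars (to_maxloc m).
pose beta : {linear res_F0 L -> res X} := free_lift (g : L -> res X).
pose K : lmodType (maxloc m) := submodule (kernel rho).
have rho_beta u : rho (beta u) = h (res_aug L u).
  rewrite !linear_free_lift.
  transitivity (free_lift (h \o id) u : res Y); last by [].
  rewrite /free_lift linear_sum; apply: eq_bigr => l _ /=.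
  by rewrite -gP; exact: linearZ.
have ker_beta x : beta (res_d1 L x) \in kernel rho.
  by rewrite inE rho_beta free_ker_lift0 linear0.
have [|c cE] := @linear_map_of _ (res_F1 L) (res K)
    (fun x => exist _ (beta (res_d1 L x)) (ker_beta x)).
  by move=> a x y; apply: val_inj; rewrite /= !linearP.
have [|b bE] := apL m K c.
  by move=> x; rewrite cE; apply: val_inj; rewrite /= free_ker_lift0 linear0.
have [|d dE] := @linear_map_of _ (res_F0 L) (res X)
    (fun u => beta u - (val (b u) : X)).
  move=> a u v.
  transitivity (a *: beta u + beta v -
      (a *: (val (b u) : res X) + (val (b v) : res X))).
    by rewrite !linearP.
  by rewrite opprD addrACA -scalerBr.
have [|phi phiE] := res_descend (d := d).
  by move=> y; rewrite dE -bE cE /= subrr.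
exists phi => l; have <- : res_aug L (free_unit R l) = l by exact: res_aug_unit.
rewrite phiE dE -rho_beta.
transitivity (rho (beta (free_unit R l)) - rho (val (b (free_unit R l)))).
  exact: linearB.
by rewrite (eqP (valP (b (free_unit R l)))) subr0.
Qed.

(** R is free, so the augmentation F0 -> R has a linear section s and
    u - s (aug u) projects F0 onto the image of F1. *)
Lemma almost_projective_regular (R : comPzRingType) :
  almost_projective (R^o : lmodType R).
Proof.
move=> m N c c0.
pose s (r : R^o) : res_F0 R^o := r *: free_unit R (1 : R^o).
have augs r : res_aug _ (s r) = r.
  by rewrite linearZ /= res_aug_unit; exact: mulr1.
pose p u := u - s (res_aug _ u).
have p_lin : linear p.
  have s_lin : linear s by move=> a r r'; rewrite /s scalerDl -scalerA.
  by move=> a u v; rewrite /p linearP s_lin opprD addrACA -scalerBr.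
have /choice[t tE] u : exists y, res_d1 _ y = p u.
  by apply: free_ker_lift_onto; rewrite linearB /= augs subrr.
have ct y : c (t (res_d1 _ y)) = c y.
  apply/eqP; rewrite -subr_eq0 -linearB; apply/eqP/(cocycle_ker c0).
  by rewrite linearB /= tE /p free_ker_lift0 /s scale0r subr0 subrr.
have [|b bE] := linear_map_of (f := c \o t); last first.
  by exists b => y; rewrite bE /= ct.
move=> a u v /=; apply/eqP; rewrite -subr_eq0 -linearP -linearB.
apply/eqP/(cocycle_ker c0).
by rewrite linearB linearP /= !tE p_lin subrr.
Qed.

(** A linear form on L factors through the envelope f since R is almost
    projective, so f is injective when the linear forms separate points. *)
Lemma lifts_locally_separated (R : comPzRingType) (L : lmodType R) :
  (exists (P : lmodType R) (f : {linear L -> P}),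
       envelope (@almost_projective R) f /\ surjective f) ->
  (forall l : L, l != 0 -> exists k : {linear L -> R^o}, k l != 0) ->
  lifts_locally L.
Proof.
move=> [P [f [[[apP fP] _] f_onto]]] Lsep m X Y rho h rho_h.
have f_inj : injective f.
  move=> l l' fll'; apply/eqP; rewrite -subr_eq0; apply: contrapT => /negP.
  move=> /Lsep[k]; have [g <-] := fP _ (@almost_projective_regular R) k.
  by rewrite /= linearB fll' subrr linear0 eqxx.
have /choice[f' f'K] := f_onto.
have f'f l : f' (f l) = l by apply: f_inj; rewrite f'K.
have [|h' h'E] := linear_map_of (f := h \o f').
  move=> a x y; rewrite /= -linearP; congr (h _).
  by apply: f_inj; rewrite linearP !f'K.
have [|phi phiE] := almost_projective_lifts apP (h := h') (rho := rho).
  by move=> x; have [y yE] := rho_h (f' x); exists y; rewrite h'E.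
by exists (phi \o f) => l; rewrite /= phiE h'E /= f'f.
Qed.

(** * Consequences of the lifting property in the local rings *)

(** Otherwise an identity matrix would be the product of a tall matrix and a wide
    one. *)
Lemma identity_not_finite_sum (A : comPzRingType) (T : Type) (s : seq T)
    (f : nat -> T -> A) (g : T -> nat -> A) :
  (1 : A) != 0 -> ~ forall i j, \sum_(x <- s) f i x * g x j = (i == j)%:R.
Proof.
move=> A1 fg1.
pose A' : comNzRingType := HB.pack A (GRing.PzSemiRing_isNonZero.Build A A1).
pose F : 'M[A']_((size s).+1, size s) :=
  \matrix_(i, t) f i (tnth (in_tuple s) t).
pose G : 'M[A']_(size s, (size s).+1) :=
  \matrix_(t, j) g (tnth (in_tuple s) t) j.
suff : F *m G = 1%:M by move/mulmx1_min; rewrite ltnn.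
apply/matrixP => i j; rewrite !mxE; apply: etrans (fg1 i j).
by rewrite [RHS]big_tnth; apply: eq_bigr => t _; rewrite !mxE.
Qed.

Section LocalStructure.
Variable R : comPzRingType.
Hypothesis separated_lifts : forall L : lmodType R,
  (forall l : L, l != 0 -> exists k : {linear L -> R^o}, k l != 0) ->
  lifts_locally L.
Variable m : maxIdeal R.
Local Notation V := (maxloc m).
Local Notation iota := (to_maxloc m).

(** A lift of h through the free R_m-module on the set L, read in coordinates. *)
Lemma local_dual_basis (L : lmodType R) (Y : lmodType V)
    (h : {linear L -> restrict_scalars iota Y}) :
  lifts_locally L ->
  exists coord : L -> L -> V,
  [/\ forall x a l l', coord x (a *: l + l') = iota a * coord x l + coord x l',
      forall l, exists D : {fset L}, forall x, x \notin D -> coord x l = 0 &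
      forall l (D : {fset L}), (forall x, x \notin D -> coord x l = 0) ->
        (h l : Y) = \sum_(x <- D) coord x l *: (h x : Y)].
Proof.
move=> liftL.
have [|phi phiE] := liftL m (free_module V L) Y
    (free_lift (h : L -> Y)) h.
  by move=> l; exists (free_unit V l); exact: (free_lift_unit (h : L -> Y)).
exists (fun x l => (phi l : free_module V L)@_x); split.
- move=> x a l l'; rewrite linearP mcoeffD; congr (_ + _).
  exact: free_scaleE.
- by move=> l; exists (msupp (phi l)) => x; exact: mcoeff_outdom.
- move=> l D Dl; rewrite -phiE; apply: free_liftEw; apply/fsubsetP => x.
  by apply: contraLR => /Dl lx0; rewrite -mcoeff_eq0 lx0.
Qed.

(** In an ideal, coord x r * x = coord x (x r) = coord x x * r by commutativity.
    So the dual basis relation r = sum_x (coord x r) x becomes r = e r. *)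
Lemma ideal_trace_unit (I : submodClosed R^o) :
  exists coord : submodule I -> submodule I -> V,
  (forall x a l, coord x (a *: l) = iota a * coord x l) /\
  forall r : submodule I, exists D : {fset submodule I},
    iota (val r) = (\sum_(x <- D) coord x x) * iota (val r).
Proof.
have [h hE] : exists h : {linear submodule I -> restrict_scalars iota V^o},
    forall x, h x = iota (val x).
  apply: linear_map_of => a x y.
  by rewrite linearP rmorphD; congr (_ + _); exact: rmorphM.
have [|coord [coordP coord_supp coordE]] := @local_dual_basis _ V^o h.
  apply: separated_lifts => l l0.
  have [k kE] : exists k : {linear submodule I -> R^o}, k =1 val.
    by apply: linear_map_of => a x y; rewrite linearP.
  by exists k; rewrite kE; apply: contraNneq l0 => l0; apply/eqP/val_inj.
have coord0 x : coord x 0 = 0.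
  by have := coordP x (-1) 0 0; rewrite scaler0 addr0 rmorphN1 mulN1r addNr.
have coordZ x a l : coord x (a *: l) = iota a * coord x l.
  by rewrite -[a *: l]addr0 coordP coord0 addr0.
exists coord; split=> // r; have [D Dr] := coord_supp r; exists D.
rewrite mulr_suml -[LHS]hE (coordE r D Dr); apply: eq_bigr => x _; rewrite hE.
transitivity (coord x (val x *: r)); first by rewrite coordZ; exact: mulrC.
transitivity (coord x (val r *: x)); last by rewrite coordZ; exact: mulrC.
by congr coord; apply: val_inj; rewrite !linearZ /=; exact: mulrC.
Qed.

(** By [ideal_trace_unit] for the ideal a R, a = e a where e is a combination of
    the coordinates of a. As a <> 0, e is not in the maximal ideal of V; and what
    annihilates a annihilates its coordinates, hence e. *)
Lemma loc_regular a : iota a != 0 -> forall v : V, iota a * v = 0 -> v = 0.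
Proof.
move=> a0 v av0.
pose I : {pred R^o} := [pred x : R^o | `[< exists b : R, x = b * a >]].
have I_closed : submod_closed I.
  split=> [|c x y]; first by apply/asboolP; exists 0; rewrite mul0r.
  move=> /asboolP[b ->] /asboolP[b' ->]; apply/asboolP.
  by exists (c * b + b'); rewrite mulrDl -mulrA.
pose IL := GRing.isSubmodClosed.Build R R^o I I_closed.
pose J : submodClosed R^o := HB.pack I IL.
have aJ : (a : R^o) \in J by apply/asboolP; exists 1; rewrite mul1r.
pose a' : submodule J := Sub (a : R^o) aJ.
have [coord [coordZ coordE]] := ideal_trace_unit J.
have [r [s [sm svr]]] := loc_map_num v.
apply: (loc_map_cancel sm); rewrite svr.
have [t tm tra0] : exists2 t, t \notin m & t * (r * a) = 0.
  apply: loc_map_eq0; rewrite rmorphM -svr.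
  by transitivity (iota s * (iota a * v)); [ring | rewrite av0 mulr0].
have [D] := coordE a'; set e := \sum_(x <- D) _ => ae.
have tre0 : iota (t * r) * e = 0.
  rewrite mulr_sumr big1 // => x _.
  have [b xE] : exists b, x = b *: a'.
    have /asboolP[b xE] := valP x.
    by exists b; apply: val_inj; rewrite linearZ.
  rewrite -coordZ -(mul0r (coord x x)) -(rmorph0 iota) -coordZ scale0r.
  congr coord; apply: val_inj; rewrite xE !linearZ linear0 /=.
  transitivity (b * (t * (r * a))); last by rewrite tra0 mulr0.
  by rewrite /GRing.scale /=; ring.
have [b [w [wm web]]] := loc_map_num e.
have [z zw1] := loc_map_inv wm.
have [bm|bm] := boolP (b \in m).
  case/eqP: a0; apply: (loc_nakayama (v := z) bm).
  rewrite -web [LHS]ae -[e in LHS]mul1r -zw1; ring.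
apply: (loc_map_cancel tm); apply: (loc_map_cancel bm).
rewrite -web.
transitivity (iota w * (iota (t * r) * e)); last by rewrite tre0 mulr0.
by rewrite rmorphM; ring.
Qed.

(** Apply [ideal_trace_unit] to the ideal J of the elements divisible by all
    powers of a. Up to units of V, x in J is a y with y in J, so that coord x x
    is a multiple of a; then r = a w r for r in J, and r = 0. *)
Lemma loc_separated a : a \in m -> iota a != 0 ->
  forall v : V, (forall k, exists w, v = iota a ^+ k * w) -> v = 0.
Proof.
move=> am a0.
have a_reg := loc_regular a0.
pose I : {pred R^o} :=
  [pred x : R^o | `[< forall k, exists w, iota x = iota a ^+ k * w >]].
have I_closed : submod_closed I.
  split=> [|c x y].
    by apply/asboolP => k; exists 0; rewrite rmorph0 mulr0.
  move=> /asboolP xI /asboolP yI; apply/asboolP => k.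
  have [[w xw] [w' yw']] := (xI k, yI k).
  by exists (iota c * w + w'); rewrite rmorphD rmorphM xw yw'; ring.
pose IL := GRing.isSubmodClosed.Build R R^o I I_closed.
pose J : submodClosed R^o := HB.pack I IL.
have [coord [coordZ coordE]] := ideal_trace_unit J.
have coord_div (x : submodule J) : exists w, coord x x = iota a * w.
  have /asboolP xI := valP x.
  have [v xv] := xI 1%N; rewrite expr1 in xv.
  have [y [s [sm svy]]] := loc_map_num v.
  (* Regularity of a gives v = a^k w from a v = a^(k+1) w. *)
  have yJ : (y : R^o) \in J.
    apply/asboolP => k; have [w xw] := xI k.+1.
    exists (iota s * w); rewrite -svy.
    have /a_reg/eqP : iota a * (v - iota a ^+ k * w) = 0.
      by rewrite mulrBr mulrA -exprS -xv -xw subrr.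
    by rewrite subr_eq0 => /eqP ->; ring.
  pose y' : submodule J := Sub (y : R^o) yJ.
  have [t tm tsx] : exists2 t, t \notin m & t * (s * val x) = t * (a * y).
    apply: loc_map_eq; rewrite !rmorphM -svy xv; ring.
  have tsc : iota (t * s) * coord x x = iota (t * a) * coord x y'.
    rewrite -!coordZ; congr coord; apply: val_inj; rewrite !linearZ /=.
    by rewrite /GRing.scale /= -!mulrA.
  have [p pt1] := loc_map_inv tm; have [q qs1] := loc_map_inv sm.
  exists (q * coord x y').
  rewrite !rmorphM in tsc.
  transitivity ((p * iota t) * (q * iota s) * coord x x).
    by rewrite pt1 qs1 !mul1r.
  transitivity (p * q * (iota t * iota s * coord x x)); first by ring.
  rewrite tsc.
  transitivity ((p * iota t) * (q * iota a * coord x y')); first by ring.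
  by rewrite pt1 mul1r; ring.
move=> v vdiv; have [r [s [sm svr]]] := loc_map_num v.
apply: (loc_map_cancel sm); rewrite svr.
have rJ : (r : R^o) \in J.
  apply/asboolP => k; have [w vw] := vdiv k.
  by exists (iota s * w); rewrite -svr vw; ring.
have [D] := coordE (Sub (r : R^o) rJ).
have [w ->] : exists w, \sum_(x <- D) coord x x = iota a * w.
  apply: (big_ind (fun u => exists w, u = iota a * w)).
  - by exists 0; rewrite mulr0.
  - by move=> _ _ [u ->] [u' ->]; exists (u + u'); rewrite mulrDr.
  - by [].
exact: loc_nakayama.
Qed.

Lemma common_avoided_power (a : R) : a \in m -> iota a != 0 -> forall s : seq V,
  exists k, forall v w, v \in s -> v = iota a ^+ k * w -> v = 0.
Proof.
move=> am a0; elim=> [|u s [k IH]]; first by exists 0%N.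
have [l ul] : exists l, forall w, u = iota a ^+ l * w -> u = 0.
  have [[l ul]|nex] := pselect (exists l, ~ exists w, u = iota a ^+ l * w).
    by exists l => w uE; case: ul; exists w.
  exists 0%N => w _; apply: (loc_separated am a0) => l.
  by apply: contrapT => ul; apply: nex; exists l.
exists (k + l)%N => v w; rewrite inE exprD => /orP[/eqP->|vs] vE.
  by apply: (ul (iota a ^+ k * w)); rewrite {1}vE; ring.
by apply: (IH v (iota a ^+ l * w) vs); rewrite {1}vE; ring.
Qed.

(** If a is nonzero in R_m, then R_m is a-adically separated and R^nat has no
    local dual basis. The reason is the one for which a product of infinitely many
    copies of a discrete valuation ring is not free: sums of infinitely many
    multiples of unit vectors by rising powers of a would need infinitely many
    nonzero coordinates. *)
Lemma maxideal_locally_zero a : a \in m -> exists2 s, s \notin m & s * a = 0.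
Proof.
move=> am; apply: loc_map_eq0; apply/eqP; apply: contrapT => /negP a0.
have a_reg := loc_regular a0.
have aX_reg k (v : V) : iota a ^+ k * v = 0 -> v = 0.
  by elim: k v => [|k IH] v; rewrite ?expr0 ?mul1r // exprS -mulrA => /a_reg/IH.
pose L : lmodType R := nat -> R^o; pose Y : lmodType V := nat -> V^o.
have [h hE] : exists h : {linear L -> restrict_scalars iota Y},
    forall f, (h f : Y) = iota \o f.
  have [|h hE] := @linear_map_of _ L (restrict_scalars iota Y)
      (fun f => (iota \o f : Y)).
    move=> c f g; apply/funext => i /=.
    by rewrite rmorphD; congr (_ + _); exact: rmorphM.
  by exists h => f; rewrite hE.
have [|coord [coordP coord_supp coordE]] := @local_dual_basis L Y h.
  apply: separated_lifts => f f0.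
  have [i fi0] : exists i, f i != 0.
    apply: contrapT => nf; case/eqP: f0; apply/funext => i.
    by apply/eqP; apply: contrapT => /negP fi; apply: nf; exists i.
  have [k kE] : exists k : {linear L -> R^o}, forall g, k g = g i.
    by apply: linear_map_of.
  by exists k; rewrite kE.
have coord0 x : coord x 0 = 0.
  by have := coordP x (-1) 0 0; rewrite scaler0 addr0 rmorphN1 mulN1r addNr.
pose e i : L := fun j => (i == j)%:R.
have /choice[k kP] i : exists k, forall x w,
    coord x (e i) = iota a ^+ k * w -> coord x (e i) = 0.
  have [D De] := coord_supp (e i).
  have [k kP] := common_avoided_power am a0 [seq coord x (e i) | x <- D].
  exists k => x w; have [xD|/De //] := boolP (x \in D).
  by apply: kP; apply: map_f.
pose K i := (\sum_(j < i) k j)%N.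
have KS i : K i.+1 = (K i + k i)%N by rewrite /K big_ord_recr.
have K_mono : {homo K : i j / (i <= j)%N}.
  by apply: homo_leq => [//|? ? ?|i]; [exact: leq_trans | rewrite KS leq_addr].
pose d : L := fun j => a ^+ K j.
(* Up to index i, d = low + a^K(i) (e_i + a^k(i) tail), where coord x kills low by
   induction; so if coord x kills d, coord x e_i is a multiple of a^k(i). *)
have vanish x : coord x d = 0 -> forall i, coord x (e i) = 0.
  move=> xd i; elim/ltn_ind: i => i IH.
  pose low : L := \sum_(j < i) a ^+ K j *: e j.
  have low0 : coord x low = 0.
    apply: (big_ind (fun f => coord x f = 0)) => //.
      by move=> f g f0 g0; rewrite -[f]scale1r coordP f0 g0 mulr0 addr0.
    by move=> j _; rewrite -[_ *: _]addr0 coordP IH // coord0 mulr0 addr0.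
  pose tail : L := fun j => if (j <= i)%N then 0 else a ^+ (K j - K i.+1).
  have dE : d = a ^+ K i *: (a ^+ k i *: tail + e i) + low.
    apply/funext => j; rewrite !fctE /low fct_sumE /d /tail /e.
    transitivity (a ^+ K i * (a ^+ k i * (if (j <= i)%N then 0
        else a ^+ (K j - K i.+1)) + (i == j)%:R)
        + \sum_(t < i) a ^+ K t * (t == j :> nat)%:R); last by [].
    have [ji|ij|->] := ltngtP j i.
    - rewrite (bigD1 (Ordinal ji)) //= eqxx mulr1 big1 ?mulr0 ?add0r ?addr0.
        by rewrite mulr0 add0r.
      move=> t; rewrite -val_eqE /= => /negPf ->; exact: mulr0.
    - rewrite big1 ?addr0; last first.
        by move=> t _; rewrite ltn_eqF ?mulr0 // (ltn_trans _ ij).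
      by rewrite -!exprD addnA -KS subnKC // K_mono.
    - rewrite big1 ?mulr0 ?add0r ?mulr1 ?addr0 // => t _.
      by rewrite ltn_eqF ?mulr0.
  move: xd; rewrite dE coordP low0 addr0 rmorphXn => /aX_reg.
  rewrite coordP rmorphXn => /eqP; rewrite addrC addr_eq0 => /eqP ei.
  by apply: (kP i x (- coord x tail)); rewrite ei mulrN.
have [D Dd] := coord_supp d.
have eE i : (h (e i) : Y) = \sum_(x <- D) coord x (e i) *: (h x : Y).
  by apply: coordE => x /Dd/vanish.
apply: (@identity_not_finite_sum V _ D (fun i x => coord x (e i))
  (fun x j => (h x : Y) j) (loc1_neq0 m)) => i j.
have /(congr1 (fun f : Y => f j)) := eE i.
by rewrite hE fct_sumE /= rmorph_nat => <-.
Qed.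

End LocalStructure.

(** * The equivalence *)

(** If the ideal of the r with r a in a R a were contained in a maximal ideal m,
    then m would contain a, hence s a = 0 for some s outside m; but this s is in
    the ideal. *)
Lemma vnr_of_locally_zero (R : comPzRingType) :
  (forall (m : maxIdeal R) a, a \in m -> exists2 s, s \notin m & s * a = 0) ->
  von_neumann_regular R.
Proof.
move=> loc0 a.
pose I : {pred R} := [pred r | `[< exists x, r * a = a * x * a >]].
have ID b u v : u \in I -> v \in I -> b * u + v \in I.
  move=> /asboolP[x ux] /asboolP[y vy]; apply/asboolP; exists (b * x + y).
  by rewrite mulrDl -mulrA ux vy; ring.
have [/asboolP[x ax]|I1] := boolP (1 \in I); first by exists x; rewrite -ax mul1r.
have [|m Im] := @maximal_ideal_above _ I.
  by split=> //; apply/asboolP; exists 0; rewrite mulr0 !mul0r.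
have aI : a \in I by apply/asboolP; exists 1; rewrite mulr1.
have [s sm sa0] := loc0 m a (Im _ aI); case/negP: sm; apply: Im.
by apply/asboolP; exists 0; rewrite sa0 mulr0 mul0r.
Qed.

Theorem theorem7 (R : comPzRingType) :
  von_neumann_regular R <->
  (forall M : lmodType R,
     exists (P : lmodType R) (f : {linear M -> P}),
       envelope (@almost_projective R) f /\ surjective f).
Proof.
split=> [vnr M | env].
  exists M, idfun; split; last by move=> y; exists y.
  split; first by split=> [|P' _ k]; [exact: vnr_almost_projective | exists k].
  by move=> h hid; exists id => x; exact: hid.
apply: vnr_of_locally_zero => m a; apply: maxideal_locally_zero => L.
exact: lifts_locally_separated.
Qed.
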